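(* Let $X = X_0+\epsilon X_1$ be a two-dimensional real polynomial vector field, $0<\epsilon\ll1$, whose critical variety $\mathcal{C}=\{X_0=0\}$ is, in a neighbourhood of a point $p_s$, the union $V(F_1)\cup V(F_2)$ of two algebraic curves with $V(F_1)\cap V(F_2)=\{p_s\}$ and intersection number one at $p_s$, subject to the standing assumptions on $X_0$ and $X_1$ listed in the context. Let $\mathfrak{X}=\{\mathcal{S}_1,\mathcal{S}_2,\mathcal{S}_3\}$ be a relaxed stratification of $\mathcal{C}$. If $\rho\circ X_1$ is a stratified vector field on $\mathfrak{X}$, then a singular canard exists.
   Context: Setting. Write $X_0 = A\,\frac{\partial}{\partial x}+B\,\frac{\partial}{\partial y}$ with $A,B$ real polynomials, and $V(P)=\{p\in\mathbb{R}^2: P(p)=0\}$. The critical variety is $\mathcal{C}=\{p\in\mathbb{R}^2 : X_0(p)=0\}=V(A)\cap V(B)$, and the problem is singular, i.e. $\dim\mathcal{C}=1$. $A$ and $B$ have two common irreducible components $F_1,F_2$ with $V(F_1)\cap V(F_2)=\{p_s\}$ and $V(F_1)\cup V(F_2)=\mathcal{C}$, the curves $V(F_1), V(F_2)$ having intersection number one at $p_s$ (so both are smooth at $p_s$ and meet transversely there). Put $F=F_1F_2$, so $V(F)=\mathcal{C}$ and its singular set is $\{p_s\}$. Everything is restricted to a neighbourhood of $p_s$ containing no other intersection points. Fast-foliation and reduced problem. $X_0$ defines a foliation of the phase space (the fast-foliation), generically transverse to $\mathcal{C}$. On the regular part $\mathcal{C}\setminus\{p_s\}$, $\pi: T_{\mathcal{C}}\mathbb{R}^2\to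 T\mathcal{C}$ denotes the projection of vectors based on $\mathcal{C}$ onto the tangent space of $\mathcal{C}$ along the fast-foliation. The reduced problem (reduced flow) is the flow of $\pi\circ X_1$ on regular sections of $\mathcal{C}$. Assumptions on $X_1$: $\|X_1(p_s)\|=O(1)$ (in particular $X_1(p_s)\neq0$), and the reduced flow has no equilibria in a sufficiently large neighbourhood of $p_s$. Whitney stratification. Locally $\mathcal{C}$ has the (minimal) Whitney stratification $\tilde{\mathfrak{X}}=\{\tilde{\mathcal{S}}_1,\dots,\tilde{\mathcal{S}}_5\}$, where $\tilde{\mathcal{S}}_1,\dots,\tilde{\mathcal{S}}_4$ are the four one-dimensional branches of $\mathcal{C}\setminus\{p_s\}$ and $\tilde{\mathcal{S}}_5=\{p_s\}$. The rank of the Jacobian $\mathrm{D}X_0$ is maximal along each one-dimensional stratum. Relaxed stratification. A relaxed stratification $\mathfrak{X}=\{\mathcal{S}_1,\mathcal{S}_2,\mathcal{S}_3\}$ is a partition of $\mathcal{C}$ (near $p_s$) into smooth manifolds in which one stratum, $\mathcal{S}_3$, is the union of two one-dimensional Whitney strata with the point $\tilde{\mathcal{S}}_5=\{p_s\}$ (only combinations for which $\mathcal{S}_3$ is smooth are allowed), and $\mathcal{S}_1,\mathcal{S}_2$ are the two remaining one-dimensional Whitney strata. The map $\rho$. $\rho$ acts on vector fields on $\tilde{\mathfrak{X}}$: on the one-dimensional Whitney strata it coincides with the projection $\pi$ along the fast-foliation, and on the zero-dimensional stratum $\{p_s\}$ it returns the restriction of the vector field to the point; thus $(\rho\circ X_1)(p_s)=X_1(p_s)$.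 Stratified vector field. A stratified vector field on a stratification is a map assigning to each stratum a smooth vector field (tangent to the stratum). That $\rho\circ X_1$ is a stratified vector field on $\mathfrak{X}$ means that its restriction to each stratum, in particular to $\mathcal{S}_3$, is a smooth vector field on that stratum. Singular canard. A singular canard is a solution of the reduced problem passing through the singular point $p_s$ with nonzero finite speed, i.e. a $C^1$ curve $\gamma:(-\delta,\delta)\to\mathcal{C}$ with $\gamma(0)=p_s$, $\gamma'(0)\neq0$, that solves the reduced problem away from $p_s$. No distinction is made between canards (attracting to repelling) and faux-canards (repelling to attracting). *)

(* Defs.v *)
From HB Require Import structures.
From mathcomp Require Import all_boot all_order all_algebra.
From mathcomp Require Import all_classical all_reals all_analysis.

Set Implicit Arguments.
Unset Strict Implicit.
Unset Printing Implicit Defensive.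

Import Order.TTheory GRing.Theory Num.Theory numFieldNormedType.Exports.
Local Open Scope classical_set_scope.
Local Open Scope ring_scope.

(* In poly2 R the outer indeterminate is the first coordinate x and the
   indeterminate of the coefficients is the second coordinate y. *)
Notation poly2 R := {poly {poly R}}.
Notation plane R := 'rV[R]_2.
Notation polyvf R := 'rV[poly2 R]_2.

Section Polynomials.
Context {R : realType}.

Definition ev (F : poly2 R) (p : plane R) : R := F.[(p 0 0)%:P].[p 0 1].

Definition evvf (X : polyvf R) (p : plane R) : plane R := \row_j ev (X 0 j) p.

Definition partial (j : 'I_2) (F : poly2 R) : poly2 R :=
  if j == 0 then deriv F else map_poly (@deriv R) F.

Definition vf_jacobian (X : polyvf R) (p : plane R) : 'M[R]_2 :=
  \matrix_(i, j) ev (partial j (X 0 i)) p.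

Definition zero_set (F : poly2 R) : set (plane R) := [set p | ev F p = 0].

Definition critical_variety (X0 : polyvf R) : set (plane R) :=
  [set p | evvf X0 p = 0].

(* Irreducibility in R[x,y]; polydiv's [irreducible_poly] over {poly R} would
   be irreducibility over the fraction field R(y). *)
Definition irreducible2 (F : poly2 R) : Prop :=
  [/\ F != 0, F \isn't a GRing.unit &
      forall G H : poly2 R, F = G * H ->
        (G \is a GRing.unit) || (H \is a GRing.unit)].

Definition common_component (F : poly2 R) (X : polyvf R) : Prop :=
  irreducible2 F /\ forall j, exists G : poly2 R, X 0 j = F * G.

(* The local ring of the plane at p, inside R(x,y), and its ideal (F, G). *)
Definition local_ring (p : plane R) : set {fraction poly2 R} :=
  [set z | exists f g : poly2 R, ev g p != 0 /\ z = tofrac f / tofrac g].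

Definition local_ideal (F G : poly2 R) (p : plane R) : set {fraction poly2 R} :=
  [set z | exists a b, [/\ local_ring p a, local_ring p b &
                           z = a * tofrac F + b * tofrac G]].

(* [n] is the R-dimension of local_ring p / (F, G): the family [e] is a basis
   of the quotient. *)
Definition intersection_number (F G : poly2 R) (p : plane R) (n : nat) : Prop :=
  exists e : 'I_n -> {fraction poly2 R},
    (forall i, local_ring p (e i)) /\
    forall z, local_ring p z ->
      exists! c : 'rV[R]_n,
        local_ideal F G p (z - \sum_(i < n) tofrac (c 0 i)%:P%:P * e i).

End Polynomials.

Section PlaneCurves.
Context {R : realType}.
Implicit Types (S T K : set (plane R)) (p v : plane R) (c phi : R -> plane R).

Definition smooth_on (d : R) c : Prop :=
  forall (n : nat) (t : R), - d < t < d -> derivable (derive1n n c) t 1.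

Definition C1_on (d : R) c : Prop :=
  forall t : R, - d < t < d ->
    derivable c t 1 /\ {for t, continuous (derive1 c)}.

(* [phi] is a regular parametrisation of a neighbourhood of p in S, and a
   homeomorphism onto it. *)
Definition local_param S p (d : R) phi : Prop :=
  [/\ 0 < d, phi 0 = p, smooth_on d phi,
      forall t, - d < t < d -> derive1 phi t != 0 &
      exists W : set (plane R),
        [/\ open W, phi @` [set t | - d < t < d] = S `&` W &
            exists psi : plane R -> R,
              {within S `&` W, continuous psi} /\
              forall t, - d < t < d -> psi (phi t) = t]].

(* Embedded one-dimensional smooth submanifold of the plane. *)
Definition smooth_curve S : Prop :=
  forall p, S p -> exists d phi, local_param S p d phi.

Definition tangent S p v : Prop :=
  exists (d : R) (c : R -> plane R),
    [/\ 0 < d, smooth_on d c, forall t, - d < t < d -> S (c t),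
        c 0 = p & derive1 c 0 = v].

Definition smooth_vector_field S (V : plane R -> plane R) : Prop :=
  (forall p, S p -> tangent S p (V p)) /\
  forall p d phi, S p -> local_param S p d phi -> smooth_on d (V \o phi).

(* Whitney's condition (b) for a one-dimensional S over T. Convergence of the
   tangent lines of S, and of the secants, is expressed by convergence of
   normalised direction vectors. *)
Definition whitney_b S T : Prop :=
  forall (x y : nat -> plane R) (t : nat -> plane R) (q u tau : plane R),
    T q ->
    (forall n, [/\ S (x n), T (y n) & x n != y n]) ->
    (forall n, tangent S (x n) (t n) /\ `|t n| = 1) ->
    x n @[n --> \oo] --> q ->
    y n @[n --> \oo] --> q ->
    (`|x n - y n|^-1 *: (x n - y n)) @[n --> \oo] --> u ->
    t n @[n --> \oo] --> tau ->
    exists a : R, u = a *: tau.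

(* The strata are the four branches [St i], i.e. the connected components of
   K \ {ps}, together with {ps}; taking whole components as strata is what
   makes the stratification minimal. *)
Record whitney_stratification K (ps : plane R) (St : 'I_4 -> set (plane R))
    : Prop := {
  branch_component : forall i, exists p,
    (K `\ ps) p /\ St i = connected_component (K `\ ps) p;
  branch_inj : injective St;
  branch_cover : K `\ ps = \bigcup_i St i;
  branch_smooth : forall i, smooth_curve (St i);
  branch_frontier : forall i, closure (St i) ps;
  branch_whitney : forall i, whitney_b (St i) [set ps] }.

Definition relaxed_stratification (ps : plane R) (St : 'I_4 -> set (plane R))
    (S1 S2 S3 : set (plane R)) : Prop :=
  exists i j k l : 'I_4,
    [/\ uniq [:: i; j; k; l], S1 = St i, S2 = St j,
        S3 = St k `|` St l `|` [set ps] & smooth_curve S3].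

Definition stratified_vector_field (strata : set (set (plane R)))
    (V : plane R -> plane R) : Prop :=
  forall S, strata S -> smooth_vector_field S V.

End PlaneCurves.

Section FastSlow.
Context {R : realType}.
Implicit Types (p v : plane R).

(* The tangent line at p of the foliation by orbits of X0, continued through
   zeros of X0 by dividing out a common factor of its components. Two such
   factorisations with a nonzero value at p give the same line. *)
Definition foliation_tangent (X0 : polyvf R) p v : Prop :=
  exists (G : poly2 R) (Y : polyvf R),
    [/\ X0 = G *: Y, evvf Y p != 0 & exists a : R, v = a *: evvf Y p].

Definition fast_transverse (X0 : polyvf R) p : Prop :=
  forall v, tangent (critical_variety X0) p v -> foliation_tangent X0 p v ->
    v = 0.

(* Projection onto the tangent line of the critical variety along the
   fast-foliation; only meaningful at regular points of the critical variety
   that satisfy [fast_transverse]. *)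
Definition fast_proj (X0 : polyvf R) p v : plane R :=
  xget 0 [set w | tangent (critical_variety X0) p w /\
                  foliation_tangent X0 p (v - w)].

Definition rho (X0 : polyvf R) (ps : plane R) (V : plane R -> plane R) p : plane R :=
  if p == ps then V p else fast_proj X0 p (V p).

(* [U] is the neighbourhood of [ps] to which the problem is restricted. *)
Definition singular_canard (X0 X1 : polyvf R) (U : set (plane R)) (ps : plane R)
    (d : R) (gamma : R -> plane R) : Prop :=
  [/\ 0 < d, C1_on d gamma, gamma 0 = ps, derive1 gamma 0 != 0 &
      forall t, - d < t < d ->
        (critical_variety X0 `&` U) (gamma t) /\
        (t != 0 -> gamma t != ps /\
           derive1 gamma t = fast_proj X0 (gamma t) (evvf X1 (gamma t)))].

End FastSlow.

(* Main.v *)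
Require Import Defs.
From HB Require Import structures.
From mathcomp Require Import all_boot all_order all_algebra.
From mathcomp Require Import all_classical all_reals all_analysis.
From mathcomp Require Import ring lra.

Set Implicit Arguments.
Unset Strict Implicit.
Unset Printing Implicit Defensive.

Import Order.TTheory GRing.Theory Num.Theory numFieldNormedType.Exports.
Local Open Scope classical_set_scope.
Local Open Scope ring_scope.

(** The stratum S3 is a smooth curve running through p_s, and rho o X1 is a
smooth vector field on it. Its value at p_s is X1(p_s), which does not vanish,
so the integral curve of rho o X1 in S3 that starts at p_s leaves it with
nonzero finite speed. Away from p_s the field is the projection of X1 along the
fast-foliation, so this integral curve solves the reduced problem there: it is
the singular canard.

What has to be built is the integral curve of a smooth field V on an embedded
curve S through a point p with V p <> 0 ([integral_curve]). In a local
parametrisation phi of S, every tangent vector of S at phi t is a multiple of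
phi' t ([local_param_tangent]), so V (phi t) = a t *: phi' t for a continuous
scalar function a with a 0 <> 0 ([tangent_field_coef]). The curve phi o s is
then an integral curve of V as soon as s' = a(s) and s 0 = 0. Separation of
variables solves this scalar autonomous equation: s is the inverse function of
the primitive of 1 / a that vanishes at 0 ([scalar_flow]). Since phi and s are
injective, the curve meets p only at time 0, so that the equation of the reduced
problem holds at all other times. *)

(** * Scalar autonomous equations near a nonequilibrium *)

Section ScalarFlow.
Context {R : realType}.
Implicit Types (a : R -> R) (d e r t x : R).

Lemma primitive_continuous a r : 0 < r ->
  (forall x, - r <= x <= r -> {for x, continuous a}) ->
  exists T : R -> R, T 0 = 0 /\
    forall x, - r < x < r -> is_derive x 1 T (a x).
Proof.
move=> r0 ca.
pose mu := @lebesgue_measure R.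
pose F x := (\int[mu]_(t in [set` `[- r, x]]) (a t))%R.
have ia : mu.-integrable `[- r, r] (EFin \o a).
  apply: continuous_compact_integrable; first exact: segment_compact.
  apply: continuous_in_subspaceT => x; rewrite inE/= in_itv/=.
  exact: ca.
exists (fun x => F x - F 0); split; first by rewrite subrr.
move=> x /andP[rx xr].
have cax : {for x, continuous a} by apply: ca; rewrite !ltW.
have [dF eF] := @continuous_FTC1_closed _ a (- r) x r xr ia rx cax.
have {}dF : derivable F x 1 by [].
rewrite derive1E in eF.
have HF : is_derive x 1 F (a x) by apply: DeriveDef.
by apply: is_derive_eq; rewrite subr0.
Qed.

(** Separation of variables: the solution s is the inverse of T(x), the integral
of 1 / a from 0 to x, so s' = 1 / T'(s) = a(s). Since T (s t) = t, the solution
takes the value 0 only at time T 0 = 0. *)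
Lemma scalar_flow_pos a d : 0 < d -> 0 < a 0 ->
  (forall x, - d < x < d -> {for x, continuous a}) ->
  exists (e : R) (s : R -> R), [/\ 0 < e, s 0 = 0 &
    forall t, - e < t < e ->
      [/\ - d < s t < d, is_derive t 1 s (a (s t)) & s t = 0 -> t = 0]].
Proof.
move=> d0 a0 ca.
have [r [r0 rd apos]] : exists r, [/\ 0 < r, r < d &
    forall x, - r <= x <= r -> 0 < a x].
  have ca0 : {for 0, continuous a} by apply: ca; rewrite oppr_lt0 d0.
  have := ca0 _ (lt_nbhsr a0) => /nbhs_ballP[/= k k0 kB].
  (* Halving keeps the closed segment inside both the ball where a is positive
     and the domain of continuity. *)
  exists (Num.min k d / 2).
  have m0 : 0 < Num.min k d by rewrite lt_min k0.
  have mk : Num.min k d <= k by rewrite ge_min lexx.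
  have md : Num.min k d <= d by rewrite ge_min lexx orbT.
  split; [lra|lra|move=> x xr].
  by apply: kB; rewrite /ball/= sub0r normrN ltr_norml; apply/andP; split; lra.
have cb x : - r <= x <= r -> {for x, continuous (fun y => (a y)^-1)}.
  move=> xr; apply: cvgV; first by rewrite gt_eqF// apos.
  by apply: ca; lra.
have [T [T0 dT]] := primitive_continuous r0 cb.
have cT x : - r < x < r -> {for x, continuous T}.
  move=> /dT HT; apply/differentiable_continuous/derivable1_diffP.
  by case: HT.
have incT x y : - r < x < r -> - r < y < r -> x < y -> T x < T y.
  move=> xr yr; apply: (@gtr0_derive1_lt_oo _ T (- r) r); rewrite ?in_itv//=.
  - by move=> z; rewrite (@in_itv _ R)/= => /dT[].
  - move=> z; rewrite (@in_itv _ R)/= => zr; have ? := dT z zr.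
    rewrite derive1E derive_val invr_gt0 apos//; lra.
  - by move=> z; rewrite inE/= (@in_itv _ R)/= => /cT.
pose s t := xget 0 [set x | - r < x < r /\ T x = t].
have sK x : - r < x < r -> s (T x) = x.
  move=> xr; rewrite /s; case: xgetP => [y _ [yr Ty]|/(_ x)]; last by case.
  by case: (ltgtP y x) => // [/(incT _ _ yr xr)|/(incT _ _ xr yr)];
    rewrite Ty ltxx.
have nearr x : - r < x < r -> \forall y \near x, - r < y < r.
  move=> xr; have : x \in `]- r, r[ by rewrite in_itv.
  by move=> /near_in_itvoo; apply: filterS => y; rewrite in_itv.
have sKn x : - r < x < r -> {near x, cancel T s}.
  by move=> /nearr; apply: filterS.
have cTn x : - r < x < r -> {near x, continuous T}.
  by move=> /nearr; apply: filterS.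
have r00 : - r < 0 < r by lra.
have [cs Ts] := near_can_continuousAcan_sym (sKn _ r00) (cTn _ r00).
rewrite T0 in cs Ts.
have s0 : s 0 = 0 by rewrite -[in s 0]T0 sK.
have sr : \forall t \near 0, - r < s t < r.
  have := nbhs_singleton cs; rewrite /continuous_at/= s0 => cs0.
  exact: cs0 _ (nearr _ r00).
have /nbhs_ballP[/= e e0 eB] : \forall t \near 0, - r < s t < r /\ T (s t) = t.
  by apply: filterI.
exists e, s; split => // t te.
have [str Tst] : - r < s t < r /\ T (s t) = t.
  by apply: eB; rewrite /ball/= sub0r normrN ltr_norml.
split; first lra.
- have /(_ _) := is_derive_inverse (sKn _ str) (cTn _ str) (dT _ str).
  by rewrite invrK Tst invr_eq0 gt_eqF; [apply|apply: apos; lra].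
- by move=> st0; rewrite -Tst st0 T0.
Qed.

(** If a 0 < 0, run the flow of - a backwards in time. *)
Lemma scalar_flow a d : 0 < d -> a 0 != 0 ->
  (forall x, - d < x < d -> {for x, continuous a}) ->
  exists (e : R) (s : R -> R), [/\ 0 < e, s 0 = 0 &
    forall t, - e < t < e ->
      [/\ - d < s t < d, is_derive t 1 s (a (s t)) & s t = 0 -> t = 0]].
Proof.
move=> d0; rewrite neq_lt => /orP[a0|a0] ca; last exact: scalar_flow_pos.
have na0 : 0 < (- a) 0 by rewrite oppr_gt0.
have cna x : - d < x < d -> {for x, continuous (- a)}.
  by move=> xd; apply: cvgN; exact: ca.
have [e [s [e0 s0 Hs]]] := scalar_flow_pos d0 na0 cna.
exists e, (fun t => s (- t)); split => //; first by rewrite oppr0.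
move=> t te; have /Hs[st ds s0t] : - e < - t < e by lra.
split => //; last by move=> /s0t; lra.
have : is_derive t 1 (s \o -%R) ((- a) (s (- t)) * -1).
  by apply: is_derive1_comp.
by rewrite mulrN1 [(- a) _]/(- a _) opprK.
Qed.

End ScalarFlow.

(** * Vector fields on embedded plane curves *)

Section CurvesInManifolds.
Context {R : realType}.
Implicit Types (S : set (plane R)) (p v : plane R) (c phi : R -> plane R).

Lemma is_derive_reparam (V : normedModType R) (f : R -> V) (g : R -> R)
    (x b : R) (a : V) :
  is_derive (g x) 1 f a -> is_derive x 1 g b ->
  is_derive x 1 (f \o g) (b *: a).
Proof.
move=> [/derivable1_diffP df <-] [/derivable1_diffP dg <-].
have dfg : differentiable (f \o g) x by exact: differentiable_comp.
apply: DeriveDef; first exact/derivable1_diffP.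
by rewrite -!derive1E derive1E' // diff_comp //= diff1E // -derive1E'.
Qed.

Lemma derivable_curve_continuous c (t : R) : derivable c t 1 ->
  {for t, continuous c}.
Proof. by move=> /derivable1_diffP /differentiable_continuous. Qed.

Lemma coord_caratheodory c (t : R) (j : 'I_2) : derivable c t 1 ->
  exists h : R -> R, [/\ forall s, c s 0 j - c t 0 j = h s * (s - t),
    {for t, continuous h} & h t = derive1 c t 0 j].
Proof.
move=> dc; apply/is_derive1_caratheodory.
apply: DeriveDef; first by move/derivable_mxP: dc; apply.
by rewrite derive1E derive_mx // mxE.
Qed.

Lemma smooth_on_derivable (d : R) c (t : R) : smooth_on d c -> - d < t < d ->
  derivable c t 1.
Proof. by move=> sc td; exact: (sc 0%N). Qed.

Lemma smooth_on_derivable1 (d : R) c (t : R) : smooth_on d c -> - d < t < d ->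
  derivable (derive1 c) t 1.
Proof. by move=> sc td; exact: (sc 1%N). Qed.

Lemma near_sym_itv (d t : R) : - d < t < d -> \forall x \near t, - d < x < d.
Proof.
move=> td; have : t \in `]- d, d[ by rewrite in_itv.
by move=> /near_in_itvoo; apply: filterS => y; rewrite in_itv.
Qed.

(** A tangent vector of S at phi t is collinear with phi' t. If v = c' 0 for a
curve c in S, then c = phi o tau near 0, where tau = psi o c is only known to be
continuous. Write c s - c 0 = s H(s) and phi u - phi t = (u - t) K(u) with
H and K continuous at the base points. Then s H(s) = (tau s - t) K(tau s), so
the determinant of H(s) and K(tau s) vanishes for small s <> 0, and in the limit
also at s = 0, where it is the determinant of v and phi' t. *)
Lemma local_param_tangent S p (d : R) phi (t : R) v : local_param S p d phi ->
  - d < t < d -> tangent S (phi t) v ->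
  v 0 0 * derive1 phi t 0 1 = v 0 1 * derive1 phi t 0 0.
Proof.
move=> [d0 phi0 sphi dphi [W [oW phiW [psi [cpsi psiK]]]]] td.
move=> [e [c [e0 sc cS c0 <-]]].
have e00 : - e < 0 < e by lra.
have dc0 := smooth_on_derivable sc e00.
have dphit := smooth_on_derivable sphi td.
have [hx [hxE hxC <-]] := coord_caratheodory 0 dc0.
have [hy [hyE hyC <-]] := coord_caratheodory 1 dc0.
have [kx [kxE kxC <-]] := coord_caratheodory 0 dphit.
have [ky [kyE kyC <-]] := coord_caratheodory 1 dphit.
have SWt : (S `&` W) (phi t) by rewrite -phiW; exists t.
pose tau s := psi (c s).
have tau0 : tau 0 = t by rewrite /tau c0 psiK.
have ccont : c s @[s --> 0] --> phi t.
  have := derivable_curve_continuous dc0.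
  by rewrite /prop_for /continuous_at c0.
have SWc : \forall s \near 0, (S `&` W) (c s).
  have Wc : \forall s \near 0, W (c s).
    by apply: ccont; apply: open_nbhs_nbhs; split => //; case: SWt.
  have ec : \forall s \near (0 : R), - e < s < e by exact: near_sym_itv.
  by apply: filterS2 Wc ec => s Wcs /cS Scs.
have tauC : {for 0, continuous tau}.
  rewrite /prop_for /continuous_at /tau c0.
  have /subspace_continuousP/(_ _ SWt) psic := cpsi.
  apply: cvg_trans psic => A /= NA.
  have : \forall s \near 0, (S `&` W) (c s) -> A (psi (c s)).
    exact: ccont _ NA.
  by apply: filterS2 SWc => s ? ; apply.
have ctau : \forall s \near 0, c s = phi (tau s).
  apply: filterS SWc => s; rewrite -phiW => -[u ud uc].
  by rewrite /tau -uc psiK.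
pose D s := hx s * ky (tau s) - hy s * kx (tau s).
have DC : {for 0, continuous D}.
  have kxtC : {for 0, continuous (kx \o tau)}.
    by apply: continuous_comp => //; rewrite tau0.
  have kytC : {for 0, continuous (ky \o tau)}.
    by apply: continuous_comp => //; rewrite tau0.
  apply: cvgB; apply: cvgM => //.
have D0 : D s @[s --> 0^'] --> (0 : R).
  apply: cvg_near_cst; rewrite near_withinE.
  apply: filterS ctau => s cs s0.
  have ex : hx s * s = kx (tau s) * (tau s - t).
    by rewrite -kxE -cs -c0 hxE subr0.
  have ey : hy s * s = ky (tau s) * (tau s - t).
    by rewrite -kyE -cs -c0 hyE subr0.
  apply: (mulIf s0).
  by rewrite mul0r /D mulrBl mulrAC ex [X in _ - X]mulrAC ey; ring.
have : D 0 = 0.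
  have DC' : D s @[s --> 0^'] --> D 0.
    by apply: cvg_trans DC; apply: cvg_app; exact: cvg_within.
  exact: cvg_unique DC' D0.
by rewrite /D tau0 => /eqP; rewrite subr_eq0 => /eqP.
Qed.

Lemma row2P (u v : plane R) : u 0 0 = v 0 0 -> u 0 1 = v 0 1 -> u = v.
Proof.
move=> e0 e1; apply/rowP => -[[|[|//]] i];
  by [have -> : Ordinal i = 0 by exact: val_inj
     |have -> : Ordinal i = 1 by exact: val_inj].
Qed.

Lemma tangent_field_coef S p (d : R) phi (V : plane R -> plane R) :
  smooth_vector_field S V -> S p -> local_param S p d phi ->
  exists a : R -> R, forall t, - d < t < d ->
    {for t, continuous a} /\ V (phi t) = a t *: derive1 phi t.
Proof.
move=> [Vtan Vsm] Sp lp; have sV := Vsm _ _ _ Sp lp.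
have [d0 phi0 sphi dphi [W [_ phiW _]]] := lp.
pose N t := derive1 phi t 0 0 ^+ 2 + derive1 phi t 0 1 ^+ 2.
exists (fun t => (V (phi t) 0 0 * derive1 phi t 0 0 +
                  V (phi t) 0 1 * derive1 phi t 0 1) / N t).
move=> t td.
have N0 : N t != 0.
  apply: contra_neq (dphi t td) => /eqP; rewrite /N.
  rewrite paddr_eq0 ?sqr_ge0// !sqrf_eq0 => /andP[/eqP e0 /eqP e1].
  by apply: row2P; rewrite ?e0 ?e1 mxE.
have tanV := local_param_tangent lp td (Vtan (phi t) _).
split.
  have cf (c : R -> plane R) j : derivable c t 1 ->
      {for t, continuous (fun s => c s 0 j)}.
    move=> /derivable_curve_continuous cc.
    apply: (@continuous_comp _ _ _ c (fun v : plane R => v 0 j)) => //.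
    exact: coord_continuous.
  have cV j := cf _ j (smooth_on_derivable sV td).
  have cp j := cf _ j (smooth_on_derivable1 sphi td).
  apply: cvgM.
    by apply: cvgD; apply: cvgM; [exact: cV|exact: cp|exact: cV|exact: cp].
  by apply: cvgV => //; apply: cvgD; apply: cvgM; exact: cp.
have /tanV {}tanV : S (phi t).
  by have [] : (S `&` W) (phi t) by rewrite -phiW; exists t.
by apply: row2P; rewrite mxE; apply: (mulIf N0);
  rewrite mulrAC divfK // /N; ring: tanV.
Qed.

(** That the curve never returns to p matters for a field such as rho o X1, which
is given by a projection everywhere except at p. *)
Lemma integral_curve S (V : plane R -> plane R) p :
  smooth_curve S -> smooth_vector_field S V -> S p -> V p != 0 ->
  exists (e : R) (gamma : R -> plane R),
    [/\ 0 < e, gamma 0 = p, C1_on e gamma &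
      forall t, - e < t < e -> [/\ S (gamma t),
        derive1 gamma t = V (gamma t) & gamma t = p -> t = 0]].
Proof.
move=> Sc SV Sp Vp0.
have [d [phi lp]] := Sc _ Sp.
have [a aP] := tangent_field_coef SV Sp lp.
have sV := SV.2 _ _ _ Sp lp.
have [d0 phi0 sphi dphi [W [_ phiW [psi [_ psiK]]]]] := lp.
have d00 : - d < 0 < d by lra.
have a0 : a 0 != 0.
  apply: contra_neq Vp0 => a0.
  by have [_] := aP 0 d00; rewrite phi0 a0 scale0r.
have [e [s [e0 s0 sP]]] := scalar_flow d0 a0 (fun x xd => (aP x xd).1).
have dg t : - e < t < e -> is_derive t 1 (phi \o s) (V (phi (s t))).
  move=> te; have [sd ds _] := sP t te.
  rewrite (aP _ sd).2; apply: is_derive_reparam.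
  by rewrite derive1E; exact/derivableP/(smooth_on_derivable sphi).
have dgE t : - e < t < e -> derive1 (phi \o s) t = V (phi (s t)).
  by move=> te; have [_ <-] := dg t te; rewrite derive1E.
exists e, (phi \o s); split => //=; first by rewrite s0.
  move=> t te; split; first by case: (dg t te).
  have [sd [/derivable1_diffP/differentiable_continuous sc _] _] := sP t te.
  have cVs : {for t, continuous ((V \o phi) \o s)}.
    apply: continuous_comp => //.
    exact/derivable_curve_continuous/(smooth_on_derivable sV).
  rewrite /prop_for /continuous_at dgE //; apply: cvg_trans cVs.
  by apply: near_eq_cvg; apply: filterS (near_sym_itv te) => x /dgE /= ->.
move=> t te; have [sd _ s0t] := sP t te; split.
- by have [] : (S `&` W) (phi (s t)) by rewrite -phiW; exists (s t).
- exact: dgE.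
- rewrite -phi0 => /(congr1 psi); rewrite !psiK // => st0; exact: s0t.
Qed.

End CurvesInManifolds.

(** * Singular canards *)

Theorem proposition2p9 (R : realType)
  (X0 X1 : polyvf R) (F1 F2 : poly2 R) (ps : plane R)
  (U : set (plane R)) (St : 'I_4 -> set (plane R))
  (S1 S2 S3 : set (plane R))
  (U_open : open U) (U_ps : U ps)
  (F1_comp : common_component F1 X0) (F2_comp : common_component F2 X0)
  (F_meet : zero_set F1 `&` zero_set F2 `&` U = [set ps])
  (F_cover : (zero_set F1 `|` zero_set F2) `&` U = critical_variety X0 `&` U)
  (F_inter : intersection_number F1 F2 ps 1)
  (whitney : whitney_stratification (critical_variety X0 `&` U) ps St)
  (rank_max : forall i p, St i p -> \rank (vf_jacobian X0 p) = 1%N)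
  (transverse : forall p, (critical_variety X0 `&` U) p -> p != ps ->
     fast_transverse X0 p)
  (X1_ps : evvf X1 ps != 0)
  (no_equilibria : forall p, (critical_variety X0 `&` U) p -> p != ps ->
     fast_proj X0 p (evvf X1 p) != 0)
  (relaxed : relaxed_stratification ps St S1 S2 S3)
  (stratified : stratified_vector_field [set S1; S2; S3]
     (rho X0 ps (evvf X1))) :
  exists (d : R) (gamma : R -> plane R), singular_canard X0 X1 U ps d gamma.
Proof.
have [i [j [k [l [_ _ _ S3E S3smooth]]]]] := relaxed.
have S3field : smooth_vector_field S3 (rho X0 ps (evvf X1)).
  by apply: stratified; right.
have S3ps : S3 ps by rewrite S3E; right.
have rho_ps : rho X0 ps (evvf X1) ps = evvf X1 ps by rewrite /rho eqxx.
have S3crit : S3 `<=` critical_variety X0 `&` U.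
  have Stcrit m p : St m p -> (critical_variety X0 `&` U) p.
    move=> Smp; suff [] : ((critical_variety X0 `&` U) `\ ps) p by [].
    by rewrite (branch_cover whitney); exists m.
  rewrite S3E => p [[|]|->]; [exact: Stcrit|exact: Stcrit|].
  rewrite -F_cover; have : [set ps] ps by [].
  by rewrite -F_meet => -[[F1ps _] _]; split=> //; left.
have rho_ps_neq0 : rho X0 ps (evvf X1) ps != 0 by rewrite rho_ps.
have [d [gamma [d0 gamma0 gammaC1 gammaP]]] :=
  integral_curve S3smooth S3field S3ps rho_ps_neq0.
exists d, gamma; split => //.
  by have [|_ -> _] := gammaP 0; [lra|rewrite gamma0].
move=> t td; have [Sg dg gps] := gammaP t td; split; first exact: S3crit.
move=> t0; have gt : gamma t != ps by apply: contra_neq t0 => /gps.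
by split => //; rewrite dg /rho (negPf gt).
Qed.
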